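(* Let $X$ be any function assigning to each type $\mathbf m$ an integer $X(\mathbf m)\ge2$. Then for every type $\mathbf m$, $$G_{\mathbf m}=C_{\mathbf m+\vec{X}(\mathbf m)}-\sum_{\mathbf k\in L(\mathbf m+\vec{X}(\mathbf m))\setminus\{\mathbf m\}}G_{\mathbf k},$$ where $\vec{X}(\mathbf m)$ denotes the basis type $\vec{j}$ with $j=X(\mathbf m)$, and $L(\mathbf p)=\{\mathbf k:\ \mathbf p=\mathbf k+\vec j\text{ for some natural }j\ge2\}$.
   Context: A type is a vector $\mathbf m=[m_2,m_3,\ldots]$ of natural numbers (indices start at $2$) with finitely many nonzero entries; $\vec j$ is the type with $1$ in position $j$ and $0$ elsewhere, and $\mathbf t^{\mathbf m}=t_2^{m_2}t_3^{m_3}\cdots$. The hyper-Catalan number is $C_{\mathbf m}=\frac{(2m_2+3m_3+4m_4+\cdots)!}{(1+m_2+2m_3+3m_4+\cdots)!\,m_2!\,m_3!\cdots}$ and $\mathbf S=\sum_{\mathbf m}C_{\mathbf m}\mathbf t^{\mathbf m}$. The Geode $\mathbf G$ is the unique formal power series with $\mathbf S-1=(t_2+t_3+t_4+\cdots)\mathbf G$, and $G_{\mathbf n}$ is its coefficient of $\mathbf t^{\mathbf n}$. *)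

(* Defs.v *)
From mathcomp Require Import all_boot all_order all_algebra.
From mathcomp Require Import finmap multiset.
From mathcomp Require Import boolp classical_sets functions cardinality fsbigop.

Set Implicit Arguments.
Unset Strict Implicit.
Unset Printing Implicit Defensive.

Import Order.TTheory GRing.Theory Num.Theory.

Local Open Scope classical_set_scope.
Local Open Scope ring_scope.

Definition tindex : Type := {j : nat | (2 <= j)%N}.

(* A type [m_2, m_3, ...] is a finitely supported function from the indices
   j >= 2 to nat, i.e. a multiset of indices: m j is the entry m_j, `+` is
   entrywise addition and mset0 is the zero type. *)
Definition ctype : Type := {mset tindex}%mset.

Definition addt (m n : ctype) : ctype := (m `+` n)%mset.

Definition basis (j : tindex) : ctype := [mset j]%mset.

Definition hyper_catalan (m : ctype) : rat :=
  ((\sum_(j <- finsupp m) val j * m j)`!)%N%:R /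
  ((1 + \sum_(j <- finsupp m) (val j).-1 * m j)`! *
   \prod_(j <- finsupp m) (m j)`!)%N%:R.

(* Formal power series in t_2, t_3, ... with rational coefficients, given by
   their coefficients: f m is the coefficient of t^m.  The ring structure that
   the library puts on functions has the pointwise product, so the unit and the
   Cauchy product are defined here. *)
Definition fps : Type := ctype -> rat.

Definition fps_one : fps := fun m => (m == mset0)%:R.

Definition antidiagonal (m : ctype) : set (ctype * ctype) :=
  [set p | addt p.1 p.2 = m].

(* A sum over an infinite set would be 0 by convention; this one is over a
   finite set, see finite_antidiagonal. *)
Definition fps_mul (f g : fps) : fps :=
  fun m => \sum_(p \in antidiagonal m) f p.1 * g p.2.

(* The series t_2 + t_3 + t_4 + ... *)
Definition fps_sumt : fps := fun m => `[< exists j : tindex, m = basis j >]%:R.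

Definition fps_S : fps := fun m => hyper_catalan m.

Definition is_geode (G : fps) : Prop :=
  fps_S \- fps_one = fps_mul fps_sumt G.

Definition L (p : ctype) : set ctype :=
  [set k | exists j : tindex, p = addt k (basis j)].

Lemma finite_antidiagonal (m : ctype) : finite_set (antidiagonal m).
Proof.
pose N := (\max_(x : finsupp m) m (val x))%N.
pose h (f : {ffun finsupp m -> 'I_N.+1}) : ctype :=
  [fsfun x : finsupp m => f x : nat].
apply: (@sub_finite_set _ _
  ((fun k : ctype => (k, (m `\` k)%mset : ctype)) @` (h @` setT))); last first.
  by do 2 apply: finite_image; exact: finite_finset.
move=> [k l] /= klm.
have kE x : m x = (k x + l x)%N by rewrite -klm /addt msetE2.
exists k; last by rewrite -klm /addt msetDKB.
exists [ffun x => inord (k (val x))] => //.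
apply/fsfunP => x; rewrite /h.
rewrite fsfun_ffun; case: insubP => [u ux <-|xm] /=.
  rewrite ffunE inordK // ltnS.
  apply: leq_trans (leq_bigmax u); rewrite kE; exact: leq_addr.
move: xm; rewrite memNfinsupp kE addn_eq0 => /andP[/eqP-> _] //.
Qed.

Lemma finite_L (p : ctype) : finite_set (L p).
Proof.
apply: (@sub_finite_set _ _ (fst @` antidiagonal p)).
  by move=> k [j ->]; exists (k, basis j).
exact/finite_image/finite_antidiagonal.
Qed.

(* Main.v *)
Require Import Defs.
From mathcomp Require Import all_boot all_order all_algebra.
From mathcomp Require Import finmap multiset.
From mathcomp Require Import boolp classical_sets functions cardinality fsbigop.

Import GRing.Theory.

Local Open Scope classical_set_scope.
Local Open Scope ring_scope.

(** Compare the coefficients at [p = addt m (basis (X m))] in the equation defining the Geode. As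
    [p] is nonzero, the constant 1 contributes nothing on the left, leaving the hyper-Catalan
    number; on the right [fps_sumt_mulE] gives the sum of [G] over [L p]. Whatever index [X] picks,
    [m] lies in [L p], so its term can be isolated. *)

(** Only pairs whose first entry is a basis type survive in the Cauchy product, and the second entry
    [k] determines the first as the difference of [p] and [k]. *)
Lemma fps_sumt_mulE (G : fps) (p : ctype) :
  fps_mul fps_sumt G p = \sum_(k \in L p) G k.
Proof.
rewrite /fps_mul.
transitivity (\sum_(q \in (fun k : ctype => ((p `\` k)%mset : ctype, k)) @` L p)
    fps_sumt q.1 * G q.2).
  (* Pairs of the antidiagonal outside this image have a first entry that is not a basis type, so
     their terms vanish. *)
  apply/esym/fsbig_widen => [q [k [j ->] <-]|[a b] [/= abp nab]].
    by rewrite /antidiagonal /= /addt msetDKB msetDC.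
  rewrite /fps_sumt /preimage /=; case: asboolP => [[j aj]|_]; last by rewrite mul0r.
  case: nab; exists b; last by rewrite -abp /addt msetDC msetDKB.
  by exists j; rewrite -abp aj /addt msetDC.
rewrite fsbig_image/=; last by move=> k l _ _ [].
apply: eq_fsbigr => k; rewrite inE => -[j ->] /=.
rewrite /fps_sumt; case: asboolP => [_|[]]; first by rewrite mul1r.
by exists j; rewrite /addt msetDKB.
Qed.

Lemma addt_basis_neq0 (m : ctype) (j : tindex) :
  addt m (basis j) != mset0.
Proof.
apply/eqP => /msetP /(_ j).
by rewrite /addt /basis msetE2 msetnE mset0E eqxx addn1.
Qed.

Theorem theorem8 (G : fps) (hG : is_geode G) (X : ctype -> tindex) (m : ctype) :
  G m = hyper_catalan (addt m (basis (X m))) -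
        \sum_(k \in L (addt m (basis (X m))) `\` [set m]) G k.
Proof.
set p := addt m (basis (X m)).
have pLm : L p m by exists (X m).
have := congr1 (fun f : fps => f p) hG.
rewrite fps_sumt_mulE /= /fps_S /fps_one (negbTE (addt_basis_neq0 _ _)) subr0 => ->.
(* Finiteness of [L p] is what allows the term at [m] to be split off. *)
by rewrite (fsbigD1 m) ?addrK //; exact: finite_L.
Qed.
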